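(* For any $1<p<\infty$, the space $V_p(\lambda)$ has the uniform Opial property.
   Context: Let $\ell^0$ be the space of all real sequences $x=(x(i))_{i=1}^\infty$. Let $(\lambda_k)_{k\ge1}$ be a nondecreasing sequence of positive real numbers tending to infinity with $\lambda_1=1$ and $\lambda_{k+1}\le\lambda_k+1$ for all $k$. For $k\ge 1$ put $I_k=[k-\lambda_k+1,\,k]$; sums over $i\in I_k$ run over the integers in this interval. The space $V_p(\lambda)$ is $$V_p(\lambda)=\left\{x\in\ell^0:\ \sum_{k=1}^\infty\left(\frac1{\lambda_k}\sum_{i\in I_k}|x(i)|\right)^p<\infty\right\},$$ equipped with the norm $\|x\|=\left(\sum_{k=1}^\infty\left(\frac1{\lambda_k}\sum_{i\in I_k}|x(i)|\right)^p\right)^{1/p}$. For a Banach space $X$, $S(X)$ denotes its unit sphere. $X$ has the uniform Opial property if for every $\varepsilon>0$ there exists $\tau>0$ such that for each weakly null sequence $\{x_n\}\subset S(X)$ and each $x\in X$ with $\|x\|\ge\varepsilon$, $$1+\tau\le\liminf_{n\to\infty}\|x_n+x\|.$$ *)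

(* Defs.v *)
From HB Require Import structures.
From mathcomp Require Import all_boot all_order all_algebra.
From mathcomp Require Import lra.
From mathcomp Require Import all_classical all_reals all_analysis.
Import Order.TTheory GRing.Theory Num.Theory.
Import numFieldNormedType.Exports.

Set Implicit Arguments.
Unset Strict Implicit.
Unset Printing Implicit Defensive.

Local Open Scope classical_set_scope.
Local Open Scope ring_scope.

Definition weakly_null (R : realType) (X : normedModType R) (u : nat -> X) :=
  forall f : {linear X -> R^o}, continuous f -> f (u n) @[n --> \oo] --> (0 : R).

(* The liminf is the extended-real one, so it is never a default value. *)
Definition uniform_opial (R : realType) (X : completeNormedModType R) :=
  forall eps : R, 0 < eps -> exists2 tau : R, 0 < tau &
    forall (u : nat -> X) (x : X),
      (forall n, `|u n| = 1) -> weakly_null u -> eps <= `|x| ->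
      ((1 + tau)%:E <= limn_einf (fun n => `|u n + x|%:E))%E.

(* Sequences indexed by k >= 1 are shifted to start at 0: lam k, x i and
   avg lam x k stand for lambda_{k+1}, x(i+1) and the average over I_{k+1}.
   Since i + 1 >= (k + 1) - lambda_{k+1} + 1 iff i >= k - lambda_{k+1} + 1, the
   lower bound of the window keeps the same form. The window never reaches below
   the first index, because lambda_{k+1} <= k + 1. *)
Record weight_seq (R : realType) := WeightSeq {
  weight :> nat -> R ;
  weight_gt0 : forall k, 0 < weight k ;
  weight_ndecr : nondecreasing_seq weight ;
  weight_cvgy : weight n @[n --> \oo] --> +oo ;
  weight_first : weight 0 = 1 ;
  weight_step : forall k, weight k.+1 <= weight k + 1 }.

Section Vp_def.
Context {R : realType}.
Implicit Types (lam : weight_seq R) (p : R) (x : nat -> R).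

Definition avg lam x (k : nat) : R :=
  (lam k)^-1 * \sum_(i < k.+1 | k%:R - lam k + 1 <= i%:R) `|x i|.

Definition Vp_sum lam p x : \bar R := (\sum_(0 <= k <oo) ((avg lam x k) `^ p)%:E)%E.

Definition Vp_norm lam p x : R := fine (Vp_sum lam p x) `^ p^-1.

Definition Vp_set lam p : {pred nat -> R} :=
  [pred x | (Vp_sum lam p x < +oo)%E].

Lemma weight_ge1 lam k : 1 <= lam k.
Proof. by rewrite -(weight_first lam) weight_ndecr. Qed.

Lemma avg_ge0 lam x k : 0 <= avg lam x k.
Proof. by rewrite mulr_ge0 ?sumr_ge0// invr_ge0 ltW// weight_gt0. Qed.

Lemma avgD lam x y k : avg lam (x + y) k <= avg lam x k + avg lam y k.
Proof.
rewrite -mulrDr ler_pM2l ?invr_gt0 ?weight_gt0// -big_split/=.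
by apply: ler_sum => i _; exact: ler_normD.
Qed.

Lemma avgZ lam a x k : avg lam (a *: x) k = `|a| * avg lam x k.
Proof.
rewrite /avg mulrCA; congr (_ * _); rewrite mulr_sumr.
by apply: eq_bigr => i _; rewrite -normrM.
Qed.

Lemma avgN lam x k : avg lam (- x) k = avg lam x k.
Proof. by rewrite -scaleN1r avgZ normrN1 mul1r. Qed.

Lemma avg0 lam k : avg lam 0 k = 0.
Proof. by rewrite -(scale0r 0) avgZ normr0 mul0r. Qed.

Lemma le_avg lam x k : `|x k| <= lam k * avg lam x k.
Proof.
rewrite /avg mulVKf ?gt_eqF ?weight_gt0//.
rewrite (bigD1 ord_max)//=; first by rewrite lerDl sumr_ge0.
by rewrite -addrA gerDl addrC subr_le0 weight_ge1.
Qed.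

Lemma Vp_sum_ge0 lam p x : (0 <= Vp_sum lam p x)%E.
Proof. by apply: nneseries_ge0 => k _ _; rewrite lee_fin powR_ge0. Qed.

Lemma Vp_setP lam p x : reflect (Vp_sum lam p x < +oo)%E (x \in Vp_set lam p).
Proof. by exact: idP. Qed.

Lemma fineK_Vp_sum lam p x : x \in Vp_set lam p ->
  (fine (Vp_sum lam p x))%:E = Vp_sum lam p x.
Proof. by move=> /Vp_setP xV; rewrite fineK// ge0_fin_numE// Vp_sum_ge0. Qed.

Lemma Vp_norm_ge0 lam p x : 0 <= Vp_norm lam p x.
Proof. exact: powR_ge0. Qed.

Lemma Vp_norm_Lnorm lam p x : 0 < p -> x \in Vp_set lam p ->
  (Vp_norm lam p x)%:E = Lnorm counting p%:E (EFin \o avg lam x).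
Proof.
move=> p0 xV; rewrite Lnorm_counting// /Vp_norm -poweR_EFin fineK_Vp_sum//.
congr (_ `^ _)%E; apply: eq_eseriesr => k _ /=.
by rewrite ger0_norm// avg_ge0.
Qed.

Lemma Vp_setE lam p x : 0 < p ->
  (x \in Vp_set lam p) = (Lnorm counting p%:E (EFin \o avg lam x) < +oo)%E.
Proof.
move=> p0; apply/Vp_setP/idP => [xV|].
  by rewrite -Vp_norm_Lnorm ?ltry//; exact/Vp_setP.
rewrite Lnorm_counting// => /lty_poweRy; rewrite gt_eqF ?invr_gt0// => /(_ isT).
congr (_ < _)%E; apply: eq_eseriesr => k _ /=.
by rewrite ger0_norm// avg_ge0.
Qed.

Lemma Lnorm_avgD lam p x y : 1 < p ->
  (Lnorm counting p%:E (EFin \o avg lam (x + y)%R) <=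
   Lnorm counting p%:E (EFin \o avg lam x) +
   Lnorm counting p%:E (EFin \o avg lam y))%E.
Proof.
move=> p1; have p0 : 0 < p by rewrite (lt_trans ltr01).
apply: le_trans (@minkowski_EFin _ nat R counting (avg lam x) (avg lam y) p _ _ (ltW p1)) => //.
rewrite !Lnorm_counting// gt0_ler_poweR ?invr_ge0 ?(ltW p0)//.
- by rewrite in_itv/= leey nneseries_ge0// => k _ _; rewrite poweR_ge0.
- by rewrite in_itv/= leey nneseries_ge0// => k _ _; rewrite poweR_ge0.
apply: lee_nneseries => [k _ _|k _]; rewrite ?poweR_ge0//= lee_fin.
apply: ge0_ler_powR; rewrite ?nnegrE ?(ltW p0) ?avg_ge0 ?normr_ge0//.
by rewrite ger0_norm ?avg_ge0// (le_trans (avgD _ _ _ _))// ler_norm.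
Qed.

Lemma Vp_sumZ lam p a x : (Vp_sum lam p (a *: x) =
  (`|a| `^ p)%:E * Vp_sum lam p x)%E.
Proof.
rewrite -nneseriesZl => [|k _]; last by rewrite lee_fin powR_ge0.
apply: eq_eseriesr => k _; rewrite avgZ -EFinM powRM ?avg_ge0//.
Qed.

Lemma Vp_normZ lam p a x : 0 < p -> x \in Vp_set lam p ->
  Vp_norm lam p (a *: x) = `|a| * Vp_norm lam p x.
Proof.
move=> p0 xV; rewrite /Vp_norm Vp_sumZ -(fineK_Vp_sum xV) -EFinM/=.
rewrite powRM ?powR_ge0 ?fine_ge0 ?Vp_sum_ge0//.
by rewrite -powRrM mulfV ?gt_eqF// powRr1.
Qed.

Lemma Vp_submod_closed lam p : 1 < p -> submod_closed (Vp_set lam p).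
Proof.
move=> p1; have p0 : 0 < p by rewrite (lt_trans ltr01).
split=> [|a x y xV yV].
  apply/Vp_setP; rewrite /Vp_sum eseries0 ?ltry// => k _ _.
  by rewrite avg0 powR0 ?gt_eqF.
rewrite Vp_setE// (le_lt_trans (Lnorm_avgD _ _ _ p1))// lte_add_pinfty//.
  rewrite -Vp_setE//; apply/Vp_setP; rewrite Vp_sumZ.
  by rewrite -(fineK_Vp_sum xV) ltry.
by rewrite -Vp_setE.
Qed.

Lemma Vp_normD lam p x y : 1 < p -> x \in Vp_set lam p -> y \in Vp_set lam p ->
  Vp_norm lam p (x + y) <= Vp_norm lam p x + Vp_norm lam p y.
Proof.
move=> p1 xV yV; have p0 : 0 < p by rewrite (lt_trans ltr01).
have xyV : x + y \in Vp_set lam p.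
  by have [_ /(_ 1 x y xV yV)] := Vp_submod_closed lam p1; rewrite scale1r.
have := Lnorm_avgD lam x y p1.
rewrite -(Vp_norm_Lnorm p0 xyV).
rewrite -(Vp_norm_Lnorm p0 xV).
rewrite -(Vp_norm_Lnorm p0 yV).
by rewrite -EFinD lee_fin.
Qed.

Lemma Vp_norm_powR lam p x : 0 < p -> x \in Vp_set lam p ->
  (Vp_norm lam p x `^ p)%:E = Vp_sum lam p x.
Proof.
move=> p0 xV; rewrite /Vp_norm -powRrM mulVf ?gt_eqF// powRr1 ?fineK_Vp_sum//.
by rewrite fine_ge0// Vp_sum_ge0.
Qed.

Lemma psum_le_Vp_norm lam p x n : 0 < p -> x \in Vp_set lam p ->
  \sum_(0 <= k < n) avg lam x k `^ p <= Vp_norm lam p x `^ p.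
Proof.
move=> p0 xV; rewrite -lee_fin Vp_norm_powR// -sumEFin.
by apply: nneseries_lim_ge => k _; rewrite lee_fin powR_ge0.
Qed.

Lemma avg_le_Vp_norm lam p x k : 0 < p -> x \in Vp_set lam p ->
  avg lam x k <= Vp_norm lam p x.
Proof.
move=> p0 xV; rewrite leNgt; apply/negP => ltx.
have := psum_le_Vp_norm k.+1 p0 xV; rewrite leNgt => /negP; apply.
rewrite big_nat_recr//= (@lt_le_trans _ _ (avg lam x k `^ p))//.
  by rewrite gt0_ltr_powR// nnegrE ?avg_ge0 ?Vp_norm_ge0.
by rewrite lerDr sumr_ge0// => i _; rewrite powR_ge0.
Qed.

Lemma coord_le_Vp_norm lam p x k : 0 < p -> x \in Vp_set lam p ->
  `|x k| <= lam k * Vp_norm lam p x.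
Proof.
move=> p0 xV; rewrite (le_trans (le_avg lam x k))//.
by rewrite ler_pM2l ?weight_gt0// avg_le_Vp_norm.
Qed.

Lemma Vp_norm_le lam p x e : 0 < p -> 0 <= e ->
  (forall n, \sum_(0 <= k < n) avg lam x k `^ p <= e `^ p) ->
  x \in Vp_set lam p /\ Vp_norm lam p x <= e.
Proof.
move=> p0 e0 xe; have le_e : (Vp_sum lam p x <= (e `^ p)%:E)%E.
  apply: lime_le; first by apply: is_cvg_nneseries => k _ _; rewrite lee_fin powR_ge0.
  by apply: nearW => n; rewrite sumEFin lee_fin.
have xV : x \in Vp_set lam p by apply/Vp_setP/(le_lt_trans le_e); rewrite ltry.
split=> //; rewrite -Vp_norm_powR// lee_fin in le_e.
rewrite leNgt; apply/negP => ltx; move: le_e; rewrite leNgt => /negP; apply.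
by rewrite gt0_ltr_powR// nnegrE Vp_norm_ge0.
Qed.

End Vp_def.

Definition Vp_pred (R : realType) (lam : weight_seq R) (p : R) of 1 < p :
  {pred nat -> R} := Vp_set lam p.
Arguments Vp_pred {R} lam {p} p1.

(* The proof of 1 < p is a parameter of the type, so that the instances below,
   which need it, can be found from the type alone. *)
Record Vp (R : realType) (lam : weight_seq R) (p : R) (p1 : 1 < p) := MkVp {
  Vp_val :> nat -> R ;
  _ : Vp_val \in Vp_pred lam p1 }.
Arguments Vp {R} lam {p} p1.

Lemma quarters_le (R : realType) (a b c : R) :
  a <= c / 4 -> b <= c / 4 -> 2 * (a + b) <= c.
Proof. by move=> ac bc; lra. Qed.

Section Vp_banach.
Context {R : realType} (lam : weight_seq R) (p : R) (p1 : 1 < p).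
Let p0 : 0 < p. Proof. exact: lt_trans ltr01 p1. Qed.

HB.instance Definition _ := [isSub of Vp lam p1 for @Vp_val R lam p p1].
HB.instance Definition _ := [Choice of Vp lam p1 by <:].
HB.instance Definition _ :=
  GRing.isSubmodClosed.Build R (nat -> R) (Vp_pred lam p1) (Vp_submod_closed lam p1).
HB.instance Definition _ := [SubChoice_isSubLmodule of Vp lam p1 by <:].

Implicit Types x y : Vp lam p1.

Lemma Vp_valP x : Vp_val x \in Vp_set lam p.
Proof. exact: (valP x). Qed.

Let nm x := Vp_norm lam p x.

Let nmD x y : nm (x + y) <= nm x + nm y.
Proof. exact: (Vp_normD p1 (Vp_valP x) (Vp_valP y)). Qed.

Let nmZ (a : R) x : nm (a *: x) = `|a| * nm x.
Proof. exact: (Vp_normZ a p0 (Vp_valP x)). Qed.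

Let nm0_eq0 x : nm x = 0 -> x = 0.
Proof.
move=> x0; apply/val_inj/funext => k /=; apply/eqP.
by rewrite -normr_le0 (le_trans (coord_le_Vp_norm k p0 (Vp_valP x)))// -/(nm x) x0 mulr0.
Qed.

HB.instance Definition _ := Lmodule_isNormed.Build R (Vp lam p1) nmD nmZ nm0_eq0.

Lemma Vp_normE x : `|x| = Vp_norm lam p x.
Proof. by []. Qed.

Lemma coord_le_norm x k : `|x k| <= lam k * `|x|.
Proof. exact: (coord_le_Vp_norm k p0 (Vp_valP x)). Qed.

Lemma cvg_avg (T : Type) (F : set_system T) (FF : Filter F)
    (u : T -> nat -> R) (v : nat -> R) k :
  (forall i, u t i @[t --> F] --> v i) -> avg lam (u t) k @[t --> F] --> avg lam v k.
Proof.
move=> uv; apply: cvgMr.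
apply: cvg_big => [|i _]; first exact: (@add_continuous R^o).
by apply: cvg_norm; exact: uv.
Qed.

Lemma Vp_complete (F : set_system (Vp lam p1)) :
  ProperFilter F -> cauchy F -> cvg F.
Proof.
move=> FF /cauchyP Fc.
have coordc i : cauchy ((fun x : Vp lam p1 => x i) @ F).
  apply: cauchy_exP => e e0.
  have [|x Fx] := Fc (e / lam i); first by rewrite divr_gt0 ?weight_gt0.
  exists (x i); move: Fx; apply: (@filterS _ F) => y; rewrite /ball/= => xy.
  rewrite (le_lt_trans (coord_le_norm (x - y) i))//.
  by rewrite mulrC -ltr_pdivlMr ?weight_gt0.
pose v i := lim ((fun x : Vp lam p1 => x i) @ F).
have Fv i : (fun x : Vp lam p1 => x i) @ F --> v i.
  exact: cauchy_cvg (coordc i).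
have key e : 0 < e -> \forall y \near F,
    (Vp_val y - v) \in Vp_set lam p /\ Vp_norm lam p (Vp_val y - v) <= e.
  move=> e0; have [|z0 Fz0] := Fc (e / 4); first by rewrite divr_gt0.
  apply: filterS (Fz0) => y y0; apply: Vp_norm_le => //; first exact: ltW.
  move=> n.
  have Fhalf (k : 'I_n) : \forall z \near F,
      avg lam (Vp_val y - v) k <= avg lam (2 *: (Vp_val y - Vp_val z)) k.
    have [a0|a0] := leP (avg lam (Vp_val y - v) k) 0.
      by apply: nearW => z; rewrite (le_trans a0)// avg_ge0.
    have /cvgr_ge : avg lam (Vp_val y - Vp_val z) k @[z --> F] -->
        avg lam (Vp_val y - v) k.
      apply: cvg_avg => i; apply: cvgB; [exact: cvg_cst|exact: Fv].
    move=> /(_ (avg lam (Vp_val y - v) k / 2)).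
    rewrite ltr_pdivrMr// ltr_pMr// ltr1n => /(_ isT); apply: filterS => z.
    by rewrite avgZ ger0_norm// ler_pdivrMr// mulrC.
  have [z [z0z hz]] := filter_ex (filterI Fz0 (filter_forall _ Fhalf)).
  pose w : Vp lam p1 := 2 *: (y - z).
  have we : Vp_norm lam p w <= e.
    rewrite -Vp_normE normrZ ger0_norm//.
    have -> : y - z = (z0 - z) - (z0 - y) by rewrite opprB [RHS]addrC subrKA.
    rewrite (le_trans (ler_wpM2l _ (ler_normB _ _)))//.
    have zz : `|z0 - z| <= e / 4 by apply: ltW; exact: z0z.
    have zy : `|z0 - y| <= e / 4 by apply: ltW; exact: y0.
    exact: quarters_le zz zy.
  apply: (@le_trans _ _ (Vp_norm lam p w `^ p)); last first.
    by apply: ge0_ler_powR; rewrite ?nnegrE ?Vp_norm_ge0 ?(ltW p0) ?(ltW e0).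
  apply: le_trans (psum_le_Vp_norm n p0 (Vp_valP w)).
  rewrite !big_mkord; apply: ler_sum => k _.
  by apply: ge0_ler_powR; rewrite ?nnegrE ?avg_ge0 ?(ltW p0)//; exact: hz.
have vV : v \in Vp_set lam p.
  have /filter_ex[y [yv _]] := key 1 ltr01.
  have [_ /(_ (-1) _ _ yv (Vp_valP y))] := Vp_submod_closed lam p1.
  by rewrite scaleN1r opprB subrK.
apply/cvg_ex; exists (MkVp vV); apply/cvgrPdist_le => e /key.
by apply: filterS => y [_ ye]; rewrite distrC.
Qed.

HB.instance Definition _ := Uniform_isComplete.Build (Vp lam p1) Vp_complete.

End Vp_banach.

(* Main.v *)
From HB Require Import structures.
Require Import Defs.
From mathcomp Require Import all_boot all_order all_algebra.
From mathcomp Require Import ring lra.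
From mathcomp Require Import all_classical all_reals all_analysis.
Import Order.TTheory GRing.Theory Num.Theory.
Import numFieldNormedType.Exports.

(** A weakly null sequence of unit vectors u_n and a fixed vector x are almost
    disjointly supported, in the following sense. The p-th power of the norm of
    y is the sum over k of [avg lam y k `^ p], and [avg lam] is subadditive in y.
    Cut this sum at an index N beyond which the tail for x is negligible. The
    averages of index below N depend on finitely many coordinates, which tend
    to 0 along u_n, so the head for u_n is negligible as well. The head for
    u_n + x is then close to that for x and its tail to that for u_n, so the
    p-th power of the norm of u_n + x is, up to an error, at least
    1 + `|x| `^ p >= 1 + eps `^ p.

    To turn perturbations of the averages into perturbations of sums of p-th
    powers, [powRD_le] gives (s + t) ^ p <= A s ^ p + B t ^ p with A as close
    to 1 as desired. Applied to the head and to the tail, it yields the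
    estimate [Vp_norm_powRD_ge], from which the theorem follows once A is chosen
    in terms of eps, then N in terms of x, and finally n large. *)

Set Implicit Arguments.
Unset Strict Implicit.
Unset Printing Implicit Defensive.

Local Open Scope classical_set_scope.
Local Open Scope ring_scope.

(** Any constant A > 1 is allowed in front of s ^ p: if t is at most a small
    multiple c * s of s, then (s + t) ^ p <= (1 + c) ^ p * s ^ p, and c is chosen
    to make (1 + c) ^ p equal to A; otherwise s < t / c and t ^ p alone, with a
    large constant, dominates. *)
Lemma powRD_le (R : realType) (p A : R) : 0 < p -> 1 < A ->
  exists2 B : R, 0 < B &
    forall s t : R, 0 <= s -> 0 <= t -> (s + t) `^ p <= A * s `^ p + B * t `^ p.
Proof.
move=> p0 A1; have A0 : 0 < A by rewrite (lt_trans ltr01).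
have [c c0 Ac] : exists2 c : R, 0 < c & (1 + c) `^ p = A.
  exists (A `^ p^-1 - 1).
    have : 1 `^ p^-1 < A `^ p^-1.
      by rewrite gt0_ltr_powR ?invr_gt0 ?nnegrE ?(ltW A0).
    by rewrite powR1 subr_gt0.
  by rewrite addrC subrK -powRrM mulVf ?gt_eqF// powRr1// ltW.
exists ((1 + c^-1) `^ p) => [|s t s0 t0].
  by rewrite powR_gt0// addr_gt0// invr_gt0.
have mono (a b : R) : 0 <= a -> a <= b -> a `^ p <= b `^ p.
  by move=> a0 ab; apply: ge0_ler_powR; rewrite ?nnegrE ?(ltW p0)// (le_trans a0).
have [tcs|cst] := leP t (c * s).
  apply: (@le_trans _ _ (A * s `^ p)); last first.
    by rewrite lerDl mulr_ge0 ?powR_ge0// ltW.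
  rewrite -{1}Ac -powRM ?addr_ge0 ?(ltW c0)// mono ?addr_ge0//.
  by rewrite mulrDl mul1r lerD2l.
apply: (@le_trans _ _ ((1 + c^-1) `^ p * t `^ p)); last first.
  by rewrite lerDr mulr_ge0 ?powR_ge0// ltW.
rewrite -powRM ?addr_ge0 ?invr_ge0 ?(ltW c0)// mono ?addr_ge0//.
by rewrite mulrDl mul1r addrC lerD2l mulrC ler_pdivlMr// mulrC ltW.
Qed.

Lemma limn_einf_ge (R : realType) (w : nat -> \bar R) (c : \bar R) :
  (\forall n \near \oo, (c <= w n)%E) -> (c <= limn_einf w)%E.
Proof.
move=> [N _ cw]; rewrite limn_einf_lim; apply: lime_ge; first exact: is_cvg_einfs.
exists N => // n /= Nn; apply: le_ereal_inf_tmp => _ [m /= nm <-].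
by apply: cw => /=; exact: leq_trans nm.
Qed.

Section Vp_opial.
Context {R : realType} (lam : weight_seq R) (p : R) (p1 : 1 < p).
Implicit Types x y u : Vp lam p1.

Let p0 : 0 < p. Proof. exact: lt_trans ltr01 p1. Qed.

Definition Vp_psum (y : nat -> R) (n : nat) : R := \sum_(0 <= k < n) avg lam y k `^ p.

Lemma Vp_psum_cvg x : Vp_psum x n @[n --> \oo] --> `|x| `^ p.
Proof.
have : (\sum_(0 <= k < n) (avg lam x k `^ p)%:E)%E @[n --> \oo] -->
    (`|x| `^ p)%:E.
  rewrite Vp_normE Vp_norm_powR ?Vp_valP//.
  by apply: is_cvg_nneseries => k _ _; rewrite lee_fin powR_ge0.
under eq_cvg do rewrite sumEFin.
by move/fine_cvgP => [].
Qed.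

(** Each coordinate functional is continuous, because the coordinate of index i
    is bounded by [lam i] times the norm. *)
Lemma weakly_null_coord (u : nat -> Vp lam p1) i :
  weakly_null u -> u n i @[n --> \oo] --> (0 : R).
Proof.
move=> u0; pose f x : R^o := x i.
have flin : linear f by [].
pose F : {linear Vp lam p1 -> R^o} :=
  HB.pack f (GRing.isLinear.Build _ _ _ _ f flin).
apply: (u0 F); apply: bounded_linear_continuous.
apply/linear_boundedP; near=> r => y.
rewrite (le_trans (coord_le_norm y i))// ler_wpM2r//.
Unshelve. all: by end_near. Qed.

(** Only finitely many coordinates enter the head, so each of its averages tends
    to 0. The averages of a unit vector are at most 1, so their p-th powers lie
    below the averages themselves and tend to 0 too. *)
Lemma Vp_psum_weakly_null (u : nat -> Vp lam p1) N :
  (forall n, `|u n| = 1) -> weakly_null u ->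
  Vp_psum (u n) N @[n --> \oo] --> (0 : R).
Proof.
move=> u1 u0.
have avg0N : \sum_(k < N) avg lam (u n) k @[n --> \oo] --> (0 : R).
  have sum0 : \sum_(k < N) (0 : R) = 0 by rewrite big1.
  rewrite -[X in _ --> X]sum0.
  apply: cvg_big => [|k _]; first exact: (@add_continuous R^o).
  rewrite -(avg0 lam k); apply: cvg_avg => i; exact: weakly_null_coord.
apply: (squeeze_cvgr _ (cvg_cst (0 : R)) avg0N).
apply: nearW => n; rewrite /Vp_psum big_mkord sumr_ge0/= => [|k _]; last exact: powR_ge0.
apply: ler_sum => k _.
have [->|a_neq0] := eqVneq (avg lam (u n) k) 0; first by rewrite powR0 ?gt_eqF.
rewrite ge1r_powR ?(ltW p1)// lt_neqAle eq_sym a_neq0 avg_ge0/=.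
by rewrite -(u1 n) Vp_normE avg_le_Vp_norm// Vp_valP.
Qed.

(** Up to an error, the p-th powers of the norms of u and x add up when u has a
    small head and x a small tail. On the terms of index below N, x is u + x
    perturbed by u; on the others, u is u + x perturbed by x. The same
    inequality for powers is used on both ranges, which is why the factor A
    multiplies the whole sum for u + x. *)
Lemma Vp_norm_powRD_ge (A B : R) :
  (forall s t : R, 0 <= s -> 0 <= t -> (s + t) `^ p <= A * s `^ p + B * t `^ p) ->
  forall u x N, `|u| `^ p + `|x| `^ p <=
    A * `|u + x| `^ p + (B + 1) * (Vp_psum u N + (`|x| `^ p - Vp_psum x N)).
Proof.
move=> AB u x N.
have avgAB (y z : nat -> R) k : avg lam y k `^ p <=
    A * avg lam (y + z) k `^ p + B * avg lam z k `^ p.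
  rewrite (le_trans _ (AB _ _ (avg_ge0 _ _ _) (avg_ge0 _ _ _)))//.
  rewrite ge0_ler_powR ?nnegrE ?addr_ge0 ?avg_ge0 ?(ltW p0)//.
  by rewrite -[in leRHS](avgN lam z) -{1}(addrK z y) avgD.
have sumAB (y z : nat -> R) m n :
    \sum_(m <= k < n) avg lam y k `^ p <=
    A * \sum_(m <= k < n) avg lam (y + z) k `^ p +
    B * \sum_(m <= k < n) avg lam z k `^ p.
  by rewrite !mulr_sumr -big_split/=; apply: ler_sum => k _; exact: avgAB.
have lhs_cvg : Vp_psum u M + Vp_psum x M @[M --> \oo] --> `|u| `^ p + `|x| `^ p.
  by apply: cvgD; exact: Vp_psum_cvg.
have rhs_cvg :
    A * Vp_psum (Vp_val (u + x)) M +
    (B + 1) * (Vp_psum u N + (Vp_psum x M - Vp_psum x N)) @[M --> \oo] -->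
    A * `|u + x| `^ p + (B + 1) * (Vp_psum u N + (`|x| `^ p - Vp_psum x N)).
  apply: cvgD; first by apply: cvgMr; exact: Vp_psum_cvg.
  apply: cvgMr; apply: cvgD; first exact: cvg_cst.
  by apply: cvgB; [exact: Vp_psum_cvg|exact: cvg_cst].
apply: (ler_cvg_to lhs_cvg rhs_cvg).
exists N => // M /= NM.
have cut (y : nat -> R) : Vp_psum y M = Vp_psum y N + \sum_(N <= k < M) avg lam y k `^ p.
  by rewrite /Vp_psum (big_cat_nat _ NM).
have tail : \sum_(N <= k < M) avg lam u k `^ p <=
    A * \sum_(N <= k < M) avg lam (Vp_val (u + x)) k `^ p +
    B * \sum_(N <= k < M) avg lam x k `^ p := sumAB u x N M.
have head : \sum_(0 <= k < N) avg lam x k `^ p <=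
    A * \sum_(0 <= k < N) avg lam (Vp_val (u + x)) k `^ p +
    B * \sum_(0 <= k < N) avg lam u k `^ p.
  by rewrite [u + x]addrC; exact: (sumAB x u 0 N).
rewrite !cut /Vp_psum; lra.
Qed.

End Vp_opial.

Theorem theorem3p3 (R : realType) (lam : weight_seq R) (p : R) (p1 : 1 < p) :
  uniform_opial (Vp lam p1).
Proof.
have p0 : 0 < p by exact: lt_trans ltr01 p1.
move=> eps eps0.
have root_ge (a b : R) : 0 <= a -> 0 <= b -> a <= b `^ p -> a `^ p^-1 <= b.
  move=> a0 b0 ab; rewrite -[leRHS](powRr1 b0) -(@mulfV _ p) ?gt_eqF// powRrM.
  by rewrite ge0_ler_powR ?invr_ge0 ?nnegrE ?powR_ge0 ?(ltW p0).
(* With A = 1 + e, a third of eps ^ p is lost to the factor A and a third to the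
   head and tail errors: (1 + e) S >= 1 + 3 e - e = 1 + 2 e, with S the p-th power of
   the norm of u n + x, so S >= c > 1, where c depends on eps and p only. *)
pose e := eps `^ p / 3.
have e0 : 0 < e by rewrite divr_gt0// powR_gt0.
have e1 : 0 < 1 + e by rewrite addr_gt0.
pose c := (1 + 2 * e) / (1 + e).
have c1 : 1 < c by rewrite ltr_pdivlMr; lra.
have [|B B0 AB] := @powRD_le R p (1 + e) p0; first by lra.
exists (c `^ p^-1 - 1) => [|u x u1 u0 xeps].
  have : 1 `^ p^-1 < c `^ p^-1.
    by rewrite gt0_ltr_powR ?invr_gt0 ?nnegrE// ltW// (lt_trans ltr01).
  by rewrite powR1 subr_gt0.
have x3e : 3 * e <= `|x| `^ p.
  by rewrite /e mulrC divfK// ge0_ler_powR ?nnegrE ?(ltW p0) ?(ltW eps0)//.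
(* N may depend on x, and the rank from which the head of u n is small on the
   whole sequence: only c has to be uniform. *)
pose d := e / (2 * (B + 1)).
have d0 : 0 < d by rewrite divr_gt0// mulr_gt0// addr_gt0.
have dE : (B + 1) * (d + d) = e.
  by rewrite /d; field; lra.
have /cvgr_gt /(_ (`|x| `^ p - d)) := @Vp_psum_cvg R lam p p1 x.
rewrite gtrBl => /(_ d0) /filter_ex [N xN].
apply: limn_einf_ge.
have /cvgr_lt /(_ d d0) := Vp_psum_weakly_null N u1 u0.
apply: filterS => n uN; rewrite lee_fin addrC subrK.
have small : (B + 1) * (Vp_psum lam p (u n) N + (`|x| `^ p - Vp_psum lam p x N)) <= e.
  by rewrite -dE ler_pM2l; lra.
have key := Vp_norm_powRD_ge AB (u n) x N.
rewrite u1 powR1 in key.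
have cux : c <= `|u n + x| `^ p.
  rewrite ler_pdivrMr//.
  have arith (X S r : R) :
      3 * e <= X -> r <= e -> 1 + X <= (1 + e) * S + r -> 1 + 2 * e <= S * (1 + e).
    by clear; lra.
  exact: arith x3e small key.
apply: root_ge cux; [exact: ltW (lt_trans ltr01 c1)|exact: normr_ge0].
Qed.
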